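(* For every odd prime $p$, every $M\in SO(3)_p$ can be written as $M=R_zR_yR_x$ with $R_x\in G_x$, $R_y\in G_y$, $R_z\in G_z$.
   Context: For $p$ odd, fix a unit $u\in\mathbb{Z}_p^\times$ that is not a square in $\mathbb{Q}_p$, and set $v=-u$ if $p\equiv 1 \pmod 4$, $v=-1$ if $p\equiv 3\pmod 4$. Let $Q_+(\mathbf{x})=x_1^2-vx_2^2+px_3^2$ with matrix $A=\mathrm{diag}(1,-v,p)$, and $SO(3)_p=\{L\in M_{3\times 3}(\mathbb{Q}_p): L^\top A L=A,\ \det L=1\}$. With $\mathbf{e}_1,\mathbf{e}_2,\mathbf{e}_3$ the canonical basis, let $G_x=\{L\in SO(3)_p:L\mathbf{e}_1=\mathbf{e}_1\}$, $G_y=\{L\in SO(3)_p:L\mathbf{e}_2=\mathbf{e}_2\}$, $G_z=\{L\in SO(3)_p:L\mathbf{e}_3=\mathbf{e}_3\}$ (the rotations around the reference axes). *)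

(* Defs.v *)
From HB Require Import structures.
From mathcomp Require Import all_boot all_order all_algebra.
From mathcomp Require Import boolp.

Set Implicit Arguments.
Unset Strict Implicit.
Unset Printing Implicit Defensive.

Import GRing.Theory.
Local Open Scope ring_scope.

(* Z_p is the inverse limit of the rings Z/p^n: an element is a coherent      *)
(* sequence of residues, x n being the representative of the n-th component   *)
(* in {0, ..., p^n - 1} (so x 0 = 0).                                         *)
Record padic_int (p : nat) (p_pr : prime p) := PadicInt {
  padic_res :> nat -> nat;
  padic_resP : forall n, (padic_res n.+1 %% p ^ n)%N = padic_res n }.

Section PadicInt.
Variables (p : nat) (p_pr : prime p).
Local Notation Zp := (padic_int p_pr).
Implicit Types x y z : Zp.

HB.instance Definition _ := gen_eqMixin Zp.
HB.instance Definition _ := gen_choiceMixin Zp.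

Lemma padic_int_ext x y : (forall n, x n = y n) -> x = y.
Proof.
case: x y => [x xP] [y yP] /= /funext eqxy.
by move: xP yP; rewrite eqxy => xP yP; rewrite (Prop_irrelevance xP yP).
Qed.

Lemma padic_expn_gt0 n : (0 < p ^ n)%N.
Proof. by rewrite expn_gt0 prime_gt0. Qed.

Lemma padic_modS a n : (a %% p ^ n.+1 = a %[mod p ^ n])%N.
Proof. by rewrite modn_dvdm // dvdn_exp2l. Qed.

Lemma padic_res_mod x n : (x n %% p ^ n)%N = x n.
Proof. by rewrite -(padic_resP x n) modn_mod. Qed.

Lemma padic_res_ltn x n : (x n < p ^ n)%N.
Proof. by rewrite -padic_res_mod ltn_pmod // padic_expn_gt0. Qed.

Lemma padic_res_modD x n m : (x (n + m) %% p ^ n)%N = x n.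
Proof.
elim: m => [|m IHm]; first by rewrite addn0 padic_res_mod.
rewrite -[RHS]IHm -(padic_resP x (n + m)) addnS.
by rewrite modn_dvdm // dvdn_exp2l // leq_addr.
Qed.

Fact padic_nat_subproof a n : (a %% p ^ n.+1 %% p ^ n = a %% p ^ n)%N.
Proof. exact: padic_modS. Qed.
Definition padic_nat (a : nat) : Zp := PadicInt p_pr (padic_nat_subproof a).

Fact padic_add_subproof x y n :
  ((x n.+1 + y n.+1) %% p ^ n.+1 %% p ^ n = (x n + y n) %% p ^ n)%N.
Proof. by rewrite padic_modS -modnDm !padic_resP. Qed.
Definition padic_add x y : Zp := PadicInt p_pr (padic_add_subproof x y).

Fact padic_mul_subproof x y n :
  ((x n.+1 * y n.+1) %% p ^ n.+1 %% p ^ n = (x n * y n) %% p ^ n)%N.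
Proof. by rewrite padic_modS -modnMm !padic_resP. Qed.
Definition padic_mul x y : Zp := PadicInt p_pr (padic_mul_subproof x y).

Fact padic_opp_subproof x n :
  ((p ^ n.+1 - x n.+1) %% p ^ n.+1 %% p ^ n = (p ^ n - x n) %% p ^ n)%N.
Proof.
rewrite padic_modS; apply/eqP; rewrite -(eqn_modDr (x n)).
rewrite subnK ?(ltnW (padic_res_ltn _ _)) // -modnDmr -{1}(padic_resP x n).
rewrite modn_mod modnDmr subnK ?(ltnW (padic_res_ltn _ _)) //.
by rewrite expnS modnMl modnn.
Qed.
Definition padic_opp x : Zp := PadicInt p_pr (padic_opp_subproof x).

Fact padic_addA : associative padic_add.
Proof.
by move=> x y z; apply: padic_int_ext => n /=; rewrite modnDmr modnDml addnA.
Qed.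

Fact padic_addC : commutative padic_add.
Proof. by move=> x y; apply: padic_int_ext => n /=; rewrite addnC. Qed.

Fact padic_add0 : left_id (padic_nat 0) padic_add.
Proof.
by move=> x; apply: padic_int_ext => n /=; rewrite mod0n add0n padic_res_mod.
Qed.

Fact padic_addN : left_inverse (padic_nat 0) padic_opp padic_add.
Proof.
move=> x; apply: padic_int_ext => n /=.
by rewrite modnDml subnK ?(ltnW (padic_res_ltn _ _)) // modnn mod0n.
Qed.

HB.instance Definition _ :=
  GRing.isZmodule.Build Zp padic_addA padic_addC padic_add0 padic_addN.

Fact padic_mulA : associative padic_mul.
Proof.
by move=> x y z; apply: padic_int_ext => n /=; rewrite modnMmr modnMml mulnA.
Qed.

Fact padic_mulC : commutative padic_mul.
Proof. by move=> x y; apply: padic_int_ext => n /=; rewrite mulnC. Qed.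

Fact padic_mul1 : left_id (padic_nat 1) padic_mul.
Proof.
move=> x; apply: padic_int_ext => n /=.
by rewrite modnMml mul1n padic_res_mod.
Qed.

Fact padic_mulDl : left_distributive padic_mul padic_add.
Proof.
move=> x y z; apply: padic_int_ext => n /=.
by rewrite modnMml modnDm mulnDl.
Qed.

Fact padic_1neq0 : padic_nat 1 != 0.
Proof.
apply/eqP => /(congr1 (fun x : Zp => x 1)) /=.
by rewrite expn1 mod0n modn_small // prime_gt1.
Qed.

HB.instance Definition _ := GRing.Zmodule_isComNzRing.Build Zp
  padic_mulA padic_mulC padic_mul1 padic_mulDl padic_1neq0.

Definition padic_unit : {pred Zp} := [pred x | `[< exists y, y * x = 1 >]].

Definition padic_inv x : Zp :=
  if pselect (exists y, y * x = 1) is left ex_y then projT1 (cid ex_y) else x.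

Fact padic_mulVx : {in padic_unit, left_inverse 1 padic_inv *%R}.
Proof.
move=> x /asboolP ex_y; rewrite /padic_inv.
by case: pselect => // ex_y'; case: cid.
Qed.

Fact padic_unitPl x y : y * x = 1 -> padic_unit x.
Proof. by move=> yx1; apply/asboolP; exists y. Qed.

Fact padic_inv_out : {in [predC padic_unit], padic_inv =1 id}.
Proof.
by move=> x /asboolPn not_ex; rewrite /padic_inv; case: pselect.
Qed.

HB.instance Definition _ := GRing.ComNzRing_hasMulInverse.Build Zp
  padic_mulVx padic_unitPl padic_inv_out.

Fact padic_idomain : GRing.integral_domain_axiom Zp.
Proof.
move=> x y xy0; apply/norP => -[x0 y0].
have ex_res z : z != 0 -> exists n, z n != 0%N.
  move=> z0; apply: contrapT => noz; case/eqP: z0; apply: padic_int_ext => n.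
  rewrite /= mod0n; apply/eqP; rewrite -[_ == _]negbK.
  by apply/negP => zn; apply: noz; exists n.
have [n xn] := ex_res _ x0; have [m ym] := ex_res _ y0.
have xN : ~~ (p ^ n %| x (n + m))%N by rewrite /dvdn padic_res_modD.
have yN : ~~ (p ^ m %| y (n + m))%N by rewrite /dvdn addnC padic_res_modD.
have gt0 k a : ~~ (p ^ k %| a)%N -> (0 < a)%N.
  by rewrite lt0n; apply: contraNneq => ->; rewrite dvdn0.
have lx : (logn p (x (n + m)%N) < n)%N.
  by rewrite ltnNge -pfactor_dvdn // (gt0 _ _ xN).
have ly : (logn p (y (n + m)%N) < m)%N.
  by rewrite ltnNge -pfactor_dvdn // (gt0 _ _ yN).
have := congr1 (fun z : Zp => z (n + m)%N) xy0.
rewrite /= mod0n => /eqP; rewrite -/(dvdn _ _) pfactor_dvdn //; last first.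
  by rewrite muln_gt0 (gt0 _ _ xN) (gt0 _ _ yN).
rewrite lognM ?(gt0 _ _ xN) ?(gt0 _ _ yN) // leqNgt => /negP; apply.
by rewrite -addSn leq_add // ltnW.
Qed.

HB.instance Definition _ :=
  GRing.ComUnitRing_isIntegral.Build Zp padic_idomain.

End PadicInt.

Definition padic (p : nat) (p_pr : prime p) : fieldType :=
  {fraction padic_int p_pr}.

Definition padic_of_int (p : nat) (p_pr : prime p) (x : padic_int p_pr) :
  padic p_pr := tofrac x.

Lemma diag3_form (R : comNzRingType) (a b c : R) (x : 'cV[R]_3) :
  (x^T *m diag_mx (\row_(i < 3) [:: a; b; c]`_i) *m x) 0 0 =
  a * x 0 0 ^+ 2 + b * x 1 0 ^+ 2 + c * x 2 0 ^+ 2.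
Proof.
have e1 : lift ord0 ord0 = 1 :> 'I_3 by apply: val_inj.
have e2 : lift ord0 (lift ord0 ord0) = 2 :> 'I_3 by apply: val_inj.
rewrite mul_mx_diag mxE !big_ord_recl big_ord0 e1 e2 !mxE /= addr0 addrA.
by rewrite !expr2 !mulrA ![x _ 0 * _]mulrC.
Qed.

Section Rotations.
Variables (p : nat) (p_pr : prime p).
Local Notation Qp := (padic p_pr).

Definition nonsquare_unit (u : padic_int p_pr) : Prop :=
  u \is a GRing.unit /\ ~ exists y : Qp, y ^+ 2 = padic_of_int u.

Variable u : padic_int p_pr.

(* For odd p the second branch is the case p = 3 mod 4. *)
Definition vcoef : Qp :=
  if (p %% 4 == 1)%N then - padic_of_int u else - 1.

Definition Qplus (x : 'cV[Qp]_3) : Qp :=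
  x 0 0 ^+ 2 - vcoef * x 1 0 ^+ 2 + p%:R * x 2 0 ^+ 2.

Definition Aplus : 'M[Qp]_3 :=
  diag_mx (\row_(i < 3) [:: 1; - vcoef; p%:R]`_i).

Lemma QplusE x : (x^T *m Aplus *m x) 0 0 = Qplus x.
Proof. by rewrite diag3_form mul1r mulNr. Qed.

Definition SO3p (L : 'M[Qp]_3) : Prop :=
  L^T *m Aplus *m L = Aplus /\ \det L = 1.

Definition rot_axis (i : 'I_3) (L : 'M[Qp]_3) : Prop :=
  SO3p L /\ L *m delta_mx i 0 = delta_mx i 0 :> 'cV_3.

(* Coordinates are numbered from 0. *)
Definition Gx := rot_axis 0.
Definition Gy := rot_axis 1.
Definition Gz := rot_axis 2.

End Rotations.

(* Main.v *)
Require Import Defs.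
From HB Require Import structures.
From mathcomp Require Import all_boot all_order all_algebra.
From mathcomp Require Import finfield generic_quotient fraction boolp ring.

(* Let w = M e_1, so that w_1^2 - v w_2^2 = 1 - p w_3^2. The form             *)
(* x^2 - v y^2 is anisotropic modulo p, hence takes values of even valuation; *)
(* this forces w_3 to be integral, as 1 - p w_3^2 would otherwise have odd    *)
(* valuation. By Hensel's lemma 1 - p w_3^2 is then a nonzero square a^2.     *)
(* Some R_y carries e_1 to (a, 0, w_3), some R_z carries this to w, and       *)
(* (R_z R_y)^-1 M fixes e_1.                                                  *)

Set Implicit Arguments.
Unset Strict Implicit.
Unset Printing Implicit Defensive.

Import GRing.Theory.
Local Open Scope ring_scope.

(** The decomposition exists as soon as $x^2-vy^2$ at the first column of $M$ is a nonzero square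
    $a^2$; from there [diag_form_Euler] is pure algebra over any field. The arithmetic input is that
    $v$ is not a square modulo $p$ ([vcoef_int_red_nonsquare]). The valuation argument is run as a
    descent ([padic_norm_square_int]). Clearing denominators gives $x^2-vy^2+pz^2=d^2$ in
    $\mathbb{Z}_p$. If $p$ divides $d$, anisotropy modulo $p$ makes it divide $x$ and $y$, hence
    $z$, and all four are divided by $p$. Once $d$ is a unit, $d^2-pz^2$ is a square by
    [padic_Hensel_sqr]. *)

(** * Residues of p-adic integers and Hensel's lemma for squares *)

Section PadicIntegers.
Variables (p : nat) (p_pr : prime p).
Local Notation Zp := (padic_int p_pr).
Implicit Types x y z : Zp.

Lemma padic_resD x y n : (x + y) n = ((x n + y n) %% p ^ n)%N.
Proof. by []. Qed.

Lemma padic_resM x y n : (x * y) n = ((x n * y n) %% p ^ n)%N.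
Proof. by []. Qed.

Lemma padic_res0 n : (0 : Zp) n = 0%N.
Proof. exact: mod0n. Qed.

Lemma padic_res1 n : (1 : Zp) n = (1 %% p ^ n)%N.
Proof. by []. Qed.

Lemma padic_res_nat a n : (a%:R : Zp) n = (a %% p ^ n)%N.
Proof.
elim: a => [|a IHa]; first by rewrite padic_res0 mod0n.
by rewrite -addn1 natrD padic_resD IHa padic_res1 modnDm.
Qed.

Lemma padic_resB_eq0 x y n : ((x - y) n == 0%N) = (x n == y n).
Proof.
apply/eqP/eqP => [xy0|xy].
  by rewrite -[x](subrK y) padic_resD xy0 padic_res_mod.
by rewrite padic_resD xy -padic_resD subrr padic_res0.
Qed.

Lemma padic_res_eq0_dvdn x n m :
  (n <= m)%N -> (x n == 0%N) = (p ^ n %| x m)%N.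
Proof. by move=> /subnKC <-; rewrite /dvdn padic_res_modD. Qed.

Lemma padic_res_eq0_leq x n m : (n <= m)%N -> x m = 0%N -> x n = 0%N.
Proof.
by move=> le_nm xm; apply/eqP; rewrite (padic_res_eq0_dvdn _ le_nm) xm.
Qed.

Lemma padic_resM_eq0 x y n m :
  x n = 0%N -> y m = 0%N -> (x * y) (n + m)%N = 0%N.
Proof.
move=> /eqP xn /eqP ym; apply/eqP; rewrite padic_resM -/(dvdn _ _) expnD.
by apply: dvdn_mul; rewrite -padic_res_eq0_dvdn ?leq_addr ?leq_addl.
Qed.

Lemma padic_resMl_eq0 x y n : x n = 0%N -> (x * y) n = 0%N.
Proof. by rewrite padic_resM => ->; rewrite mul0n mod0n. Qed.

Lemma padic_eq0 x : (forall n, x n = 0%N) -> x = 0.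
Proof. by move=> x0; apply: padic_int_ext => n; rewrite x0 padic_res0. Qed.

Definition padic_red x : 'F_p := (x 1%N)%:R.

Fact padic_red_zmod : zmod_morphism padic_red.
Proof.
move=> x y; apply/(canRL (addrK _)); rewrite -[in RHS](subrK y x).
by rewrite /padic_red [in RHS]padic_resD expn1 Fp_nat_mod // natrD.
Qed.

Fact padic_red_monoid : monoid_morphism padic_red.
Proof.
split=> [|x y]; rewrite /padic_red ?padic_res1 ?padic_resM expn1 Fp_nat_mod //.
by rewrite natrM.
Qed.

HB.instance Definition _ :=
  GRing.isZmodMorphism.Build Zp 'F_p padic_red padic_red_zmod.
HB.instance Definition _ :=
  GRing.isMonoidMorphism.Build Zp 'F_p padic_red padic_red_monoid.

Lemma padic_red_eq0 x : (padic_red x == 0) = (x 1%N == 0%N).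
Proof.
rewrite -[x 1%N]padic_res_mod expn1 -val_eqE /padic_red /=.
by rewrite val_Fp_nat.
Qed.

Lemma padic_red_p : padic_red p%:R = 0.
Proof. by rewrite rmorph_nat pchar_Fp_0. Qed.

Lemma padic_redB_mulp x y : padic_red (x - p%:R * y) = padic_red x.
Proof. by rewrite rmorphB rmorphM /= padic_red_p mul0r subr0. Qed.

Lemma padic_red_surj (a : 'F_p) : exists x : Zp, padic_red x = a.
Proof. by exists (nat_of_ord a)%:R; rewrite rmorph_nat natr_Zp. Qed.

(** Division by $p$ shifts the sequence: the quotient has [x n.+1 %/ p] as its [n]-th residue. *)
Lemma padic_red_eq0_mulp x : padic_red x = 0 -> exists y, x = p%:R * y.
Proof.
move/eqP; rewrite padic_red_eq0 => x1.
have pdvd n : (p %| x n.+1)%N.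
  by rewrite -[p in (p %| _)%N]expn1 -padic_res_eq0_dvdn.
have yP n : (x n.+2 %/ p %% p ^ n = x n.+1 %/ p)%N.
  by rewrite modn_divl -expnSr padic_resP.
exists (PadicInt p_pr yP); apply: padic_int_ext => n.
rewrite padic_resM padic_res_nat modnMml /= mulnC divnK //.
by rewrite padic_resP.
Qed.

Lemma padic_natp_neq0 : p%:R != 0 :> Zp.
Proof.
(* Level 2 is the first one at which the residue of $p$ is nonzero. *)
apply/eqP => /(congr1 (fun x : Zp => x 2%N)).
rewrite padic_res0 padic_res_nat modn_small; last first.
  by rewrite -{1}(expn1 p) ltn_exp2l ?prime_gt1.
by move=> p0; have := prime_gt0 p_pr; rewrite p0.
Qed.

(** Successive terms agree modulo $p^n$, so the diagonal residues form a coherent sequence. *)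
Lemma padic_limit (s : nat -> Zp) :
    (forall n, s n.+1 n = s n n) ->
  exists y : Zp, forall n, y n = s n n.
Proof.
move=> sS.
have yP n : (s n.+1 n.+1 %% p ^ n)%N = s n n by rewrite padic_resP.
by exists (PadicInt p_pr yP).
Qed.

Lemma padic_Hensel_sqr x b :
    odd p -> padic_red b != 0 -> padic_red x = padic_red b ^+ 2 ->
  exists y, y ^+ 2 = x /\ padic_red y = padic_red b.
Proof.
move=> p_odd b0 xb.
have two0 : 2%:R != 0 :> 'F_p.
  rewrite -(dvdn_pcharf (pchar_Fp p_pr)) dvdn_prime2 //.
  by apply: contraTneq p_odd => ->.
have [i ib] := padic_red_surj (2%:R * padic_red b)^-1.
(* The chord method: Newton's iteration with its slope 2 b frozen modulo p. *)
pose s := fix s n := if n is m.+1 then s m - i * (s m ^+ 2 - x) else b.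
have sP n : (s n ^+ 2 - x) n.+1 = 0%N /\ padic_red (s n) = padic_red b.
  elim: n => [|n [en sn]].
    split=> //; apply/eqP.
    by rewrite -padic_red_eq0 rmorphB rmorphXn /= xb subrr.
  have e1 : padic_red (s n ^+ 2 - x) = 0.
    by rewrite rmorphB rmorphXn /= sn xb subrr.
  split; last by rewrite /= rmorphB rmorphM /= e1 mulr0 subr0.
  (* The new error is the old one, zero modulo $p^{n+1}$, times a factor that vanishes modulo $p$
     because [i] inverts $2b$ there; each step gains one digit. *)
  have -> : s n.+1 ^+ 2 - x = (s n ^+ 2 - x) *
     (1 - 2%:R * s n * i + i ^+ 2 * (s n ^+ 2 - x)) by rewrite /=; ring.
  rewrite -[n.+2]addn1; apply: padic_resM_eq0 => //; apply/eqP.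
  rewrite -padic_red_eq0; move: (_ - x) e1 => e e1.
  rewrite rmorphD rmorphB !rmorphM rmorph1 rmorph_nat /= e1 sn ib.
  by rewrite mulr0 addr0 mulfV ?subrr // mulf_neq0.
have sS n : s n.+1 n.+1 = s n n.+1.
  apply/eqP; rewrite -padic_resB_eq0.
  have -> : s n.+1 - s n = (s n ^+ 2 - x) * - i by rewrite /=; ring.
  by rewrite padic_resMl_eq0 // (sP n).1.
have [|y yP] := @padic_limit s.
  by move=> n; rewrite -[LHS]padic_resP sS padic_resP.
exists y; split.
  apply/eqP; rewrite -subr_eq0; apply/eqP/padic_eq0 => n.
  apply/eqP; rewrite padic_resB_eq0 expr2 padic_resM yP -padic_resM -expr2.
  rewrite -padic_resB_eq0; apply/eqP.
  exact: padic_res_eq0_leq (leqnSn n) (sP n).1.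
by rewrite -(sP 1%N).2 /padic_red yP.
Qed.

End PadicIntegers.

(** * Whether -1 is a square modulo p *)

Section QuadraticResidues.
Variables (p : nat) (p_pr : prime p).

(** With $p=4k+1$, at most $2k$ of the $4k$ nonzero elements are roots of $X^{2k}-1$. For any other
    $g$, Fermat gives $g^{4k}=1$, so $g^{2k}=-1$ and $g^k$ is the root sought. *)
Lemma Fp_sqrN1_exists : p = 1 %[mod 4] -> exists s : 'F_p, s ^+ 2 = -1.
Proof.
move=> p1; pose k := (p %/ 4)%N.
have pE : p = (4 * k).+1 by rewrite [LHS](divn_eq p 4) p1 addn1 mulnC.
have pP : p.-1 = (4 * k)%N by rewrite {1}pE.
have k_gt0 : (0 < k)%N.
  by rewrite lt0n; apply/eqP => k0; have := prime_gt1 p_pr; rewrite pE k0.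
have [g g0 gh] : exists2 g : 'F_p, g != 0 & g ^+ (2 * k) != 1.
  apply/exists_inP; apply: contraTT (k_gt0); rewrite negb_exists_in.
  move=> /forall_inP gP; rewrite -leqNgt.
  have /max_unity_roots : (0 < 2 * k)%N by rewrite muln_gt0.
  move=> /(_ _ (enum (predC1 (0 : 'F_p)))).
  rewrite enum_uniq -cardE cardC1 card_Fp // pP.
  rewrite leq_pmul2r ?k_gt0 //.
  have: all (2 * k).-unity_root (enum (predC1 (0 : 'F_p))).
    apply/allP => g; rewrite mem_enum unity_rootE => /gP.
    by rewrite negbK.
  by move=> -> /(_ isT isT).
exists (g ^+ k); apply/eqP; rewrite -exprM mulnC.
have : (g ^+ (2 * k)) ^+ 2 == 1.
  rewrite -exprM; apply/eqP/(mulfI g0); rewrite mulr1 -exprS.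
  by rewrite mulnAC -pE -[RHS]expf_card card_Fp.
by rewrite sqrf_eq1 (negPf gh).
Qed.

(** With $p=2(2k+1)+1$, $s^2=-1$ would give $s^p=-s$, whereas Fermat gives $s^p=s$. *)
Lemma Fp_sqr_neqN1 (s : 'F_p) : p = 3 %[mod 4] -> s ^+ 2 != -1.
Proof.
move=> p3; pose k := (p %/ 4)%N.
have pE : p = (2 * (2 * k).+1).+1.
  by rewrite [LHS](divn_eq p 4) p3 mulnC -/k mulnS mulnA addnC.
apply/eqP => s2.
have s0 : s != 0.
  by apply: contra_eq_neq s2 => ->; rewrite expr0n eq_sym oppr_eq0 oner_eq0.
have : s ^+ (2 * (2 * k).+1).+1 = s by rewrite -pE -[RHS]expf_card card_Fp.
rewrite exprS exprM s2 exprS exprM.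
rewrite sqrrN !expr1n mulr1 mulrN1 => /esym/eqP.
rewrite -addr_eq0 -mulr2n -mulr_natr mulf_eq0 (negPf s0) /=.
rewrite -(dvdn_pcharf (pchar_Fp p_pr)) dvdn_prime2 // => /eqP p2.
by rewrite p2 in p3.
Qed.

End QuadraticResidues.

(** * The norm form modulo p and the descent *)

Section Descent.
Variables (p : nat) (p_pr : prime p) (p_odd : odd p).
Local Notation Zp := (padic_int p_pr).
Local Notation Qp := (padic p_pr).
Implicit Types x y v : Zp.

(** A square root modulo $p$ of a unit is nonzero, so Hensel would lift it to a square root of
    [u]. *)
Lemma nonsquare_unit_red u t :
  nonsquare_unit u -> t ^+ 2 != padic_red (u : Zp).
Proof.
move=> [u_unit u_nsq]; apply/eqP => tu; apply: u_nsq.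
have [b bt] := padic_red_surj p_pr t.
have u0 : padic_red u != 0.
  by rewrite -unitfE rmorph_unit.
have [||y [yu _]] := @padic_Hensel_sqr p p_pr u b p_odd.
- by rewrite bt; apply: contraNneq u0 => t0; rewrite -tu t0 expr0n.
- by rewrite bt.
by exists (padic_of_int y); rewrite /padic_of_int -rmorphXn yu.
Qed.

Definition vcoef_int (u : Zp) : Zp := if (p %% 4 == 1)%N then - u else -1.

Lemma vcoefE u : vcoef u = padic_of_int (vcoef_int u).
Proof.
rewrite /vcoef /vcoef_int /padic_of_int.
by case: ifP => _; rewrite rmorphN ?rmorph1.
Qed.

(** If $p\equiv 1$ modulo 4 and $s^2=-1$, then $t^2=-u$ would give $(st)^2=u$. Otherwise $v=-1$ and
    $p\equiv 3$. *)
Lemma vcoef_int_red_nonsquare u t :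
  nonsquare_unit u -> t ^+ 2 != padic_red (vcoef_int u).
Proof.
move=> hu; rewrite /vcoef_int; case: ifP => [/eqP p1|p1]; rewrite rmorphN.
  have [s s2] := Fp_sqrN1_exists p_pr p1.
  have := nonsquare_unit_red (s * t) hu.
  by rewrite exprMn s2 mulN1r; apply: contra_neq => ->; rewrite opprK.
rewrite rmorph1; apply: (Fp_sqr_neqN1 p_pr).
have := p_odd; rewrite (divn_eq p 4) oddD oddM andbF /=.
have := ltn_pmod p (isT : 0 < 4)%N; rewrite modnMDl modn_mod.
by case: (p %% 4)%N p1 => [|[|[|[|]]]].
Qed.

(** Were $y$ nonzero modulo $p$, $v$ would be the square of $x/y$ there. *)
Lemma padic_red_norm_eq0 v x y : (forall t, t ^+ 2 != padic_red v) ->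
  padic_red (x ^+ 2 - v * y ^+ 2) = 0 -> padic_red x = 0 /\ padic_red y = 0.
Proof.
move=> v_nsq /eqP; rewrite rmorphB rmorphXn rmorphM rmorphXn subr_eq0 /= => xy.
have y0 : padic_red y = 0.
  apply/eqP/contraT => y0; have := v_nsq (padic_red x / padic_red y).
  by rewrite expr_div_n (eqP xy) mulfK ?eqxx // expf_neq0.
split=> //; apply/eqP; move: xy; rewrite y0 expr0n mulr0.
by rewrite expf_eq0.
Qed.

(** Descent on [n], a strict upper bound for the valuation of [d]. *)
Lemma padic_norm_square_int v n (x y z d : Zp) :
    (forall t, t ^+ 2 != padic_red v) ->
    d n != 0%N -> x ^+ 2 - v * y ^+ 2 + p%:R * z ^+ 2 = d ^+ 2 ->
  exists2 a, a != 0 & a ^+ 2 = x ^+ 2 - v * y ^+ 2.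
Proof.
move=> v_nsq; elim: n x y z d => [|n IHn] x y z d dn xyzd.
  (* Every residue at level 0 is 0, so the base case is vacuous. *)
  by have := padic_res_ltn d 0; rewrite expn0 ltnS leqn0 (negPf dn).
have xyE : x ^+ 2 - v * y ^+ 2 = d ^+ 2 - p%:R * z ^+ 2 by rewrite -xyzd addrK.
have [d0|d0] := eqVneq (padic_red d) 0; last first.
  rewrite xyE; set e := d ^+ 2 - _.
  have [|a [a2 ad]] := padic_Hensel_sqr p_odd d0 (x := e).
    by rewrite padic_redB_mulp rmorphXn.
  (* The root is nonzero since it reduces to the nonzero class of [d]. *)
  by exists a => //; apply: contraNneq d0 => a0; rewrite -ad a0 rmorph0.
have [] := padic_red_norm_eq0 v_nsq (x := x) (y := y).
  by rewrite xyE padic_redB_mulp rmorphXn /= d0 expr0n.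
move=> /padic_red_eq0_mulp[x' xE] /padic_red_eq0_mulp[y' yE].
have [d' dE] := padic_red_eq0_mulp d0.
have pI := mulfI (padic_natp_neq0 p_pr).
have /padic_red_eq0_mulp[z' zE] : padic_red z = 0.
  (* The other three terms are divisible by $p^2$, so $pz^2$ is too. *)
  have zE : z ^+ 2 = p%:R * (d' ^+ 2 - (x' ^+ 2 - v * y' ^+ 2)).
    apply: (pI); rewrite -[LHS](addKr (x ^+ 2 - v * y ^+ 2)) xyzd xE yE dE.
    by ring.
  by apply/eqP; rewrite -sqrf_eq0 -rmorphXn zE rmorphM /= padic_red_p mul0r.
have [||a a0 a2] := IHn x' y' z' d'.
- apply: contraNneq dn => d'n; rewrite dE -[n.+1]add1n padic_resM_eq0 //.
  by apply/eqP; rewrite -padic_red_eq0 padic_red_p.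
- apply/pI/pI; transitivity (d ^+ 2); last by rewrite dE; ring.
  by rewrite -xyzd xE yE zE; ring.
exists (p%:R * a); first by rewrite mulf_neq0 ?padic_natp_neq0.
by rewrite exprMn a2 xE yE; ring.
Qed.

Lemma padic_ratio (w : Qp) :
  exists x y, y != 0 /\ w = padic_of_int x / padic_of_int y.
Proof.
elim/quotW: w => -[[x y] /= y0]; exists x, y; split=> //.
have fy0 : padic_of_int y != 0 by rewrite /padic_of_int tofrac_eq0.
(* With the denominator cleared, equality of classes of fractions is a cross-product identity. *)
apply: (mulIf fy0); rewrite divfK // /padic_of_int; unlock FracField.tofrac.
rewrite -[LHS]FracField.pi_mul; apply/eqP; rewrite FracField.equivf_def.
rewrite /FracField.mulf !numden_Ratio ?mulf_neq0 ?oner_neq0 //= !mulr1.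
by rewrite mulrC.
Qed.

Lemma padic_common_denominator (w1 w2 w3 : Qp) :
  exists (x1 x2 x3 d : Zp), d != 0 /\
    [/\ padic_of_int x1 = w1 * padic_of_int d,
        padic_of_int x2 = w2 * padic_of_int d &
        padic_of_int x3 = w3 * padic_of_int d].
Proof.
have [x1 [y1 [y10 ->]]] := padic_ratio w1.
have [x2 [y2 [y20 ->]]] := padic_ratio w2.
have [x3 [y3 [y30 ->]]] := padic_ratio w3.
have F0 y : y != 0 -> padic_of_int y != 0 by rewrite /padic_of_int tofrac_eq0.
have FM x y : padic_of_int (x * y) = padic_of_int x * padic_of_int y.
  exact: tofracM.
exists (x1 * (y2 * y3)), (x2 * (y1 * y3)), (x3 * (y1 * y2)), (y1 * y2 * y3).
split; first by rewrite !mulf_neq0.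
split; first by rewrite -[y1 * _ * _]mulrA !FM [RHS]mulrA divfK ?F0.
  by rewrite [y1 * y2]mulrC -[y2 * _ * _]mulrA !FM [RHS]mulrA divfK ?F0.
by rewrite [_ * y3]mulrC !FM [RHS]mulrA divfK ?F0.
Qed.

(** A common denominator $d$ multiplies the equation by $d^2$; the integral root is then divided by
    $d$. *)
Lemma padic_norm_square v (w1 w2 w3 : Qp) :
    (forall t, t ^+ 2 != padic_red v) ->
    w1 ^+ 2 - padic_of_int v * w2 ^+ 2 + p%:R * w3 ^+ 2 = 1 ->
  exists2 a, a != 0 & a ^+ 2 = w1 ^+ 2 - padic_of_int v * w2 ^+ 2.
Proof.
move=> v_nsq w_sphere.
have [x1 [x2 [x3 [d [d0 [x1E x2E x3E]]]]]] := padic_common_denominator w1 w2 w3.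
have normE : padic_of_int (x1 ^+ 2 - v * x2 ^+ 2) =
    (w1 ^+ 2 - padic_of_int v * w2 ^+ 2) * padic_of_int d ^+ 2.
  rewrite /padic_of_int tofracB tofracXn tofracM tofracXn.
  rewrite -!/(padic_of_int _) x1E x2E.
  by rewrite !exprMn [RHS]mulrBl; congr (_ - _); exact: mulrA.
have [n dn] : exists n, d n != 0%N.
  apply/not_existsP => dn; case/eqP: d0; apply: padic_eq0 => n.
  by apply/eqP; rewrite -[_ == _]negbK; apply/negP/dn.
have [|a a0 a2] := padic_norm_square_int v_nsq dn (x := x1) (y := x2) (z := x3).
  apply/eqP; rewrite -tofrac_eq; apply/eqP; rewrite tofracD.
  rewrite [X in X + _]normE tofracM !tofracXn -!/(padic_of_int _) x3E.
  rewrite -[RHS]mul1r -w_sphere [RHS]mulrDl /padic_of_int rmorph_nat exprMn.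
  by congr (_ + _); exact: mulrA.
have fd0 : padic_of_int d != 0 by rewrite /padic_of_int tofrac_eq0.
exists (padic_of_int a / padic_of_int d).
  by rewrite mulf_neq0 ?invr_eq0 // /padic_of_int tofrac_eq0.
apply: (mulIf (expf_neq0 2 fd0)); rewrite -normE -exprMn divfK //.
by rewrite -a2 /padic_of_int tofracXn.
Qed.

End Descent.

(** * The special orthogonal group of a bilinear form *)

Section SpecialOrthogonal.
Variables (F : fieldType) (n : nat) (A : 'M[F]_n).

Definition special_orthogonal (L : 'M[F]_n) :=
  L^T *m A *m L = A /\ \det L = 1.

Lemma special_orthogonal_unit L : special_orthogonal L -> L \in unitmx.
Proof. by case=> _ dL; rewrite unitmxE dL unitr1. Qed.

Lemma special_orthogonalM L K : special_orthogonal L -> special_orthogonal K ->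
  special_orthogonal (L *m K).
Proof.
move=> [LA dL] [KA dK]; split; last by rewrite det_mulmx dL dK mulr1.
by rewrite trmx_mul -!mulmxA (mulmxA L^T) (mulmxA (L^T *m A)) LA mulmxA.
Qed.

Lemma special_orthogonalV L :
  special_orthogonal L -> special_orthogonal (invmx L).
Proof.
move=> Lso; have [LA dL] := Lso; have Lu := special_orthogonal_unit Lso.
split; last by rewrite det_inv dL invr1.
rewrite -{1}LA -!mulmxA mulmxV // mulmx1 !mulmxA -trmx_mul mulmxV //.
by rewrite trmx1 mul1mx.
Qed.

End SpecialOrthogonal.

(** * Axis rotations of a ternary diagonal form and the Euler decomposition *)

Section DiagonalForm.
Variable (F : fieldType).

Definition mx3 (s : seq (seq F)) : 'M[F]_3 :=
  \matrix_(i < 3, j < 3) (nth [::] s i)`_j.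

Lemma det_mx3 (a b c d e f g h i : F) :
  \det (mx3 [:: [:: a; b; c]; [:: d; e; f]; [:: g; h; i]]) =
  a * (e * i - f * h) - b * (d * i - f * g) + c * (d * h - e * g).
Proof.
rewrite (expand_det_row _ 0) !big_ord_recl big_ord0 /cofactor.
rewrite !(expand_det_row _ 0) !big_ord_recl !big_ord0 /cofactor !det_mx11.
by rewrite !mxE /= /bump /=; ring.
Qed.

Definition diag3 (a b c : F) : 'M[F]_3 :=
  diag_mx (\row_(i < 3) [:: a; b; c]`_i).

(** On the first two coordinates this is multiplication by $c+s\sqrt{w}$, an element of norm 1. *)
Lemma rot_z_special_orthogonal (w q c s : F) : c ^+ 2 - w * s ^+ 2 = 1 ->
  special_orthogonal (diag3 1 (- w) q)
    (mx3 [:: [:: c; w * s; 0]; [:: s; c; 0]; [:: 0; 0; 1]]).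
Proof.
move=> cs; split; last by rewrite det_mx3 -[RHS]cs; ring.
rewrite mul_mx_diag; apply/matrixP => i j.
rewrite mxE !big_ord_recl big_ord0 !mxE /=.
case: i => [[|[|[|//]]] ?] /=; case: j => [[|[|[|//]]] ?] //=;
  rewrite ?mulr1n ?mulr0n;
  (* Two diagonal entries need the norm relation, inserted as a factor 1; the rest are polynomial
     identities. *)
  first [ring | rewrite -[RHS]mulr1 -[X in _ = _ * X]cs; ring].
Qed.

(** Likewise, multiplication by $a+b\sqrt{-q}$ on the first and third coordinates. *)
Lemma rot_y_special_orthogonal (w q a b : F) : a ^+ 2 + q * b ^+ 2 = 1 ->
  special_orthogonal (diag3 1 w q)
    (mx3 [:: [:: a; 0; - (q * b)]; [:: 0; 1; 0]; [:: b; 0; a]]).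
Proof.
move=> cs; split; last by rewrite det_mx3 -[RHS]cs; ring.
rewrite mul_mx_diag; apply/matrixP => i j.
rewrite mxE !big_ord_recl big_ord0 !mxE /=.
case: i => [[|[|[|//]]] ?] /=; case: j => [[|[|[|//]]] ?] //=;
  rewrite ?mulr1n ?mulr0n;
  first [ring | rewrite -[RHS]mulr1 -[X in _ = _ * X]cs; ring].
Qed.

Lemma mx3_mul_delta (s : seq (seq F)) (j : 'I_3) :
  mx3 s *m delta_mx j 0 = \col_i (nth [::] s i)`_j.
Proof. by rewrite -colE; apply/colP => i; rewrite !mxE. Qed.

Lemma diag_form_Euler (v q a : F) (M : 'M[F]_3) :
    special_orthogonal (diag3 1 (- v) q) M -> a != 0 ->
    a ^+ 2 = M 0 0 ^+ 2 - v * M 1 0 ^+ 2 ->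
    let S := special_orthogonal (diag3 1 (- v) q) in
    let fixes L (i : 'I_3) := L *m delta_mx i 0 = delta_mx i 0 :> 'cV_3 in
  exists Rx Ry Rz, [/\ S Rx /\ fixes Rx 0, S Ry /\ fixes Ry 1,
    S Rz /\ fixes Rz 2 & M = Rz *m Ry *m Rx].
Proof.
move=> MS a0 aE S fixes.
have M_sphere : a ^+ 2 + q * M 2 0 ^+ 2 = 1.
  have := congr1 (fun L : 'M_3 => L 0 0) MS.1.
  rewrite mul_mx_diag !mxE !big_ord_recl big_ord0 !mxE /= aE.
  have -> : lift ord0 ord0 = 1 :> 'I_3 by apply: val_inj.
  have -> : lift ord0 (lift ord0 ord0) = 2 :> 'I_3 by apply: val_inj.
  by move=> M00; rewrite -[RHS]M00; ring.
pose Ry := mx3 [:: [:: a; 0; - (q * M 2 0)]; [:: 0; 1; 0]; [:: M 2 0; 0; a]].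
(* [Ry] sends $e_1$ to $(a,0,M_{31})$; [Rz] must then send $(a,0)$ to $(M_{11},M_{21})$, which fixes
   its first column. *)
pose c := M 0 0 / a; pose s := M 1 0 / a.
pose Rz := mx3 [:: [:: c; v * s; 0]; [:: s; c; 0]; [:: 0; 0; 1]].
have RyS : S Ry by apply: rot_y_special_orthogonal.
have RzS : S Rz.
  apply: rot_z_special_orthogonal; rewrite /c /s !expr_div_n mulrA -mulrBl -aE.
  by rewrite divff ?expf_neq0.
have RS : S (Rz *m Ry) by apply: special_orthogonalM.
have Re : Rz *m Ry *m delta_mx 0 0 = M *m delta_mx 0 0 :> 'cV_3.
  rewrite -mulmxA mx3_mul_delta -colE; apply/colP => i; rewrite !mxE.
  rewrite !big_ord_recl big_ord0 !mxE /=.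
  case: i => [[|[|[|//]]] ?] /=;
  rewrite ?mulr0 ?mul0r ?mul1r ?addr0 ?add0r ?divfK //;
  by congr (M _ _); apply: val_inj.
have RU := special_orthogonal_unit RS.
exists (invmx (Rz *m Ry) *m M), Ry, Rz; split.
- split; first by apply: special_orthogonalM => //; apply: special_orthogonalV.
  by rewrite /fixes -mulmxA -Re mulmxA mulVmx // mul1mx.
- split=> //; rewrite /fixes mx3_mul_delta; apply/colP => i; rewrite !mxE.
  by case: i => [[|[|[|//]]] ?].
- split=> //; rewrite /fixes mx3_mul_delta; apply/colP => i; rewrite !mxE.
  by case: i => [[|[|[|//]]] ?].
- by rewrite mulmxA mulmxV // mul1mx.
Qed.

End DiagonalForm.

Theorem theorem9 (p : nat) (p_pr : prime p) (p_odd : odd p)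
    (u : padic_int p_pr) (hu : nonsquare_unit u)
    (M : 'M[padic p_pr]_3) (hM : SO3p u M) :
  exists Rx Ry Rz : 'M[padic p_pr]_3,
    [/\ Gx u Rx, Gy u Ry, Gz u Rz & M = (Rz *m Ry *m Rx)%R].
Proof.
have v_nsq t := @vcoef_int_red_nonsquare p p_pr p_odd u t hu.
(* The first column of $M$ has the same value of $Q_+$ as $e_1$, namely 1. *)
have M_sphere : M 0 0 ^+ 2 - vcoef u * M 1 0 ^+ 2 + p%:R * M 2 0 ^+ 2 = 1.
  have := QplusE u (M *m delta_mx 0 0); rewrite trmx_mul !mulmxA.
  rewrite -(mulmxA _ M^T) -(mulmxA _ (M^T *m _)) hM.1 QplusE.
  rewrite /Qplus -colE !mxE /=.
  by move=> <-; rewrite !expr0n !expr1n /= !mulr0 !addr0 subr0.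
have [a a0 aE] :
    exists2 a, a != 0 & a ^+ 2 = M 0 0 ^+ 2 - vcoef u * M 1 0 ^+ 2.
  by rewrite vcoefE in M_sphere *; apply: padic_norm_square M_sphere.
(* [SO3p u] is, by unfolding, [special_orthogonal] for [diag3 1 (- vcoef u) p%:R]. *)
exact: diag_form_Euler a0 aE.
Qed.
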